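(* Let $I,J\subset\mathbb{R}$ be open intervals, let $f,\lambda: I\to\mathbb{R}$ be smooth functions with $f(t)^2\ge \lambda(t)^2$ for all $t\in I$, and let \[g = \left(f(t)^2 + u^2\right)dt^2 + 2\sqrt{f(t)^2 - \lambda(t)^2}\,dt\,du + du^2,\qquad (t,u) \in I \times J,\] be a non-flat Riemannian metric on $I\times J$. Then $g$ is a Ricci metric if and only if there is a constant $c>0$ such that $\lambda(t)^2 = f(t)^2 = c^2$ for each $t \in I$. In particular, in that case $g = (c^2+u^2)\,dt^2 + du^2$.
   Context: All metrics are smooth. A metric on a surface is called non-flat if its Gauss curvature is not identically zero. A Riemannian metric $g$ on a surface is called a Ricci metric if its Gauss curvature $K$ satisfies the Ricci condition \[K\Delta K - \|\nabla K\|^2 - 4K^3 = 0,\] where $\nabla$, $\|\cdot\|$ are the gradient and norm with respect to $g$ and $\Delta=\mathrm{div}\,\nabla$ is the Laplace–Beltrami operator of $g$ (with the sign for which the Euclidean Laplacian is $\partial_x^2+\partial_y^2$). *)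

(* Defs.v *)
From Stdlib Require Import Reals.
From Coquelicot Require Import Coquelicot.

Open Scope R_scope.

(* The endpoints may be infinite; the empty interval is included. *)
Definition is_open_interval (I : R -> Prop) : Prop :=
  exists a b : Rbar, forall t : R, I t <-> (Rbar_lt a t /\ Rbar_lt t b).

Definition rectangle (I J : R -> Prop) : R -> R -> Prop :=
  fun x y => I x /\ J y.

(* Functions on an open set are represented by total functions; every
   notion below is local, so the values outside the set are irrelevant. *)
Definition smooth_on (I : R -> Prop) (h : R -> R) : Prop :=
  forall (n : nat) (t : R), I t -> ex_derive_n h n t.

Inductive axis : Set := ax1 | ax2.

Definition sum_axis (h : axis -> R) : R := h ax1 + h ax2.

Definition ex_partial (i : axis) (h : R -> R -> R) (x y : R) : Prop :=
  match i with
  | ax1 => ex_derive (fun s => h s y) x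
  | ax2 => ex_derive (fun s => h x s) y
  end.

Definition partial (i : axis) (h : R -> R -> R) (x y : R) : R :=
  match i with
  | ax1 => Derive (fun s => h s y) x
  | ax2 => Derive (fun s => h x s) y
  end.

Fixpoint Ck_on2 (k : nat) (U : R -> R -> Prop) (h : R -> R -> R) : Prop :=
  (forall x y, U x y -> continuity_2d_pt h x y) /\
  match k with
  | O => True
  | S k' => forall i : axis,
      (forall x y, U x y -> ex_partial i h x y) /\ Ck_on2 k' U (partial i h)
  end.

Definition smooth_on2 (U : R -> R -> Prop) (h : R -> R -> R) : Prop :=
  forall k : nat, Ck_on2 k U h.

(* [g i j x y] is the component g_ij at (x, y) of a 2-tensor in the standard
   coordinates, and [V i x y] the i-th component of a vector field. *)
Definition tensor2 : Type := axis -> axis -> R -> R -> R.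
Definition vfield : Type := axis -> R -> R -> R.

Definition riemannian_metric (U : R -> R -> Prop) (g : tensor2) : Prop :=
  (forall i j, smooth_on2 U (g i j)) /\
  (forall x y, U x y ->
     (forall i j, g i j x y = g j i x y) /\
     (forall v : axis -> R, (exists i, v i <> 0) ->
        0 < sum_axis (fun i => sum_axis (fun j => g i j x y * v i * v j)))).

Definition gdet (g : tensor2) (x y : R) : R :=
  g ax1 ax1 x y * g ax2 ax2 x y - g ax1 ax2 x y * g ax2 ax1 x y.

Definition ginv (g : tensor2) : tensor2 := fun i j x y =>
  match i, j with
  | ax1, ax1 => g ax2 ax2 x y / gdet g x y
  | ax2, ax2 => g ax1 ax1 x y / gdet g x y
  | _, _ => - g i j x y / gdet g x y
  end.

(* [christoffel g k i j] is Gamma^k_ij of the Levi-Civita connection. *)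
Definition christoffel (g : tensor2) (k i j : axis) (x y : R) : R :=
  / 2 * sum_axis (fun l => ginv g k l x y *
    (partial i (g j l) x y + partial j (g i l) x y - partial l (g i j) x y)).

(* The l-th component of R(d_i, d_j) d_k, where
   R(X, Y) Z = D_X D_Y Z - D_Y D_X Z - D_[X,Y] Z. *)
Definition riemann (g : tensor2) (l k i j : axis) (x y : R) : R :=
  partial i (christoffel g l j k) x y - partial j (christoffel g l i k) x y
  + sum_axis (fun m =>
      christoffel g l i m x y * christoffel g m j k x y
      - christoffel g l j m x y * christoffel g m i k x y).

(* g(R(d_1, d_2) d_2, d_1) / det g, positive on the round sphere. *)
Definition gauss_curvature (g : tensor2) (x y : R) : R :=
  sum_axis (fun l => g ax1 l x y * riemann g l ax2 ax1 ax2 x y) / gdet g x y.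

Definition grad (g : tensor2) (h : R -> R -> R) : vfield := fun i x y =>
  sum_axis (fun j => ginv g i j x y * partial j h x y).

Definition gnorm (g : tensor2) (V : vfield) (x y : R) : R :=
  sqrt (sum_axis (fun i => sum_axis (fun j => g i j x y * V i x y * V j x y))).

Definition gdiv (g : tensor2) (V : vfield) (x y : R) : R :=
  / sqrt (gdet g x y) *
  sum_axis (fun i => partial i (fun s r => sqrt (gdet g s r) * V i s r) x y).

Definition laplacian (g : tensor2) (h : R -> R -> R) : R -> R -> R :=
  gdiv g (grad g h).

Definition non_flat (U : R -> R -> Prop) (g : tensor2) : Prop :=
  ~ (forall x y, U x y -> gauss_curvature g x y = 0).

Definition ricci_metric (U : R -> R -> Prop) (g : tensor2) : Prop :=
  riemannian_metric U g /\
  (forall x y, U x y ->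
     let K := gauss_curvature g in
     K x y * laplacian g K x y - gnorm g (grad g K) x y ^ 2
       - 4 * K x y ^ 3 = 0).

(* The tensor E dx^2 + 2 F dx dy + G dy^2. *)
Definition quadratic_form (E F G : R -> R -> R) : tensor2 := fun i j =>
  match i, j with
  | ax1, ax1 => E
  | ax2, ax2 => G
  | _, _ => F
  end.

Definition tensor2_eq_on (U : R -> R -> Prop) (g h : tensor2) : Prop :=
  forall i j x y, U x y -> g i j x y = h i j x y.

Definition ruled_metric (f lam : R -> R) : tensor2 :=
  quadratic_form (fun t u => f t ^ 2 + u ^ 2)
                 (fun t u => sqrt (f t ^ 2 - lam t ^ 2))
                 (fun t u => 1).

(* Main.v *)
Require Import Defs.
From Stdlib Require Import Reals Lra Classical.
From Coquelicot Require Import Coquelicot.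

Open Scope R_scope.

(** Put [L = lam^2] and [phi = sqrt (f^2 - lam^2)].  The metric is then
    (L + phi^2 + u^2) dt^2 + 2 phi dt du + du^2, with determinant
    [D = L + u^2], and its u-lines are unit-speed geodesics.  Its curvature is
    [K = - L / D^2]; the shear [phi] does not enter it.

    Since [K] is rational in [u], so is the Ricci expression
    [K * Laplacian K - |grad K|^2 - 4 K^3]: it equals a quartic polynomial in
    [u], with coefficients depending on [t], divided by [D^7]
    ([sheared_ricci]).  A Ricci metric annihilates this quartic on a whole
    interval of values of [u], hence annihilates its coefficients
    ([quartic_vanishing_on_open]).  Those of [u^4], [u^2] and [1] are three
    equations in [L L''], [L'] and [phi], which force [L L' = 0] and
    [L phi = 0] ([sheared_ricci_rigid]).  So [L^2] has zero derivative, and the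
    nonnegative function [L] is constant; as the metric is not flat, the
    constant is positive, and then [phi = 0], which says [f^2 = lam^2].
    Working with [L] instead of [lam] avoids dividing by [lam] and any
    discussion of its zero set.

    Conversely, if [L] is constant and [phi = 0] then all five coefficients
    vanish. *)

(** * Partial derivatives on a rectangle *)

Definition is_partial (i : axis) (h : R -> R -> R) (x y d : R) : Prop :=
  match i with
  | ax1 => is_derive (fun s => h s y) x d
  | ax2 => is_derive (fun s => h x s) y d
  end.

(** All notions of the metric geometry are iterated partial derivatives, so
    closed formulas valid only on an open rectangle can be propagated through
    them one derivative at a time. *)
Lemma partial_eq_on (I J : R -> Prop) (oI : open I) (oJ : open J)
  (i : axis) (h h0 : R -> R -> R) (x y d : R) :
  (forall s r, I s -> J r -> h s r = h0 s r) -> I x -> J y ->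
  is_partial i h0 x y d -> partial i h x y = d.
Proof.
  intros E Ix Jy H; destruct i; simpl in *; rewrite <- (is_derive_unique _ _ _ H);
    apply Derive_ext_loc.
  - apply (filter_imp I); [intros s Is; now apply E | now apply oI].
  - apply (filter_imp J); [intros r Jr; now apply E | now apply oJ].
Qed.

(** * Auxiliary facts in one variable *)

Lemma open_interval_open (I : R -> Prop) : is_open_interval I -> open I.
Proof.
  intros (a & b & H).
  apply (open_ext (fun t : R => Rbar_lt a t /\ Rbar_lt t b)).
  - intros t; symmetry; apply H.
  - apply open_and; [apply open_Rbar_gt | apply open_Rbar_lt].
Qed.

Lemma open_interval_convex (I : R -> Prop) (a b t : R) :
  is_open_interval I -> I a -> I b -> a <= t <= b -> I t.
Proof.
  intros (l & r & H) Ia Ib [at_ tb].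
  apply H in Ia as [la _]; apply H in Ib as [_ br]; apply H; split.
  - now apply Rbar_lt_le_trans with a.
  - now apply Rbar_le_lt_trans with b.
Qed.

Lemma constant_of_zero_derivative (I : R -> Prop) (h : R -> R) (a b : R) :
  is_open_interval I -> (forall t, I t -> is_derive h t 0) ->
  I a -> I b -> h a = h b.
Proof.
  intros hI H Ia Ib.
  destruct (Rtotal_order a b) as [ab | [-> | ba]]; [ | reflexivity | ].
  - apply (eq_is_derive h); [ | exact ab].
    intros t tab; apply H; now apply (open_interval_convex I a b).
  - symmetry; apply (eq_is_derive h); [ | exact ba].
    intros t tba; apply H; now apply (open_interval_convex I b a).
Qed.

(** The finite difference of order [k] of a polynomial of degree [k] is [k!]
    times its leading coefficient times [h^k].  On an equally spaced stencil
    inside the open set, the coefficients are thus eliminated from the top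
    one down. *)
Lemma quartic_vanishing_on_open (J : R -> Prop) (a0 a1 a2 a3 a4 v : R) :
  open J -> J v ->
  (forall u, J u -> a4 * u ^ 4 + a3 * u ^ 3 + a2 * u ^ 2 + a1 * u + a0 = 0) ->
  a0 = 0 /\ a1 = 0 /\ a2 = 0 /\ a3 = 0 /\ a4 = 0.
Proof.
  intros oJ Jv H.
  destruct (oJ v Jv) as [eps He].
  pose proof (cond_pos eps) as He0.
  set (h := eps / 3).
  assert (h0 : 0 < h) by (unfold h; lra).
  assert (P : forall k, -2 <= k <= 2 -> J (v + k * h)).
  { intros k Hk; apply He.
    change (Rabs (v + k * h - v) < eps).
    apply Rabs_def1; unfold h; nra. }
  assert (Q := fun k Hk => H _ (P k Hk)).
  assert (Q0 := Q 0 ltac:(lra)); assert (Q1 := Q 1 ltac:(lra));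
  assert (Q2 := Q 2 ltac:(lra)); assert (Q3 := Q (-1) ltac:(lra));
  assert (Q4 := Q (-2) ltac:(lra)).
  assert (hn : forall c n, c <> 0 -> c * h ^ n <> 0).
  { intros c n Hc; apply Rmult_integral_contrapositive_currified; [exact Hc|].
    apply pow_nonzero; lra. }
  assert (E4 : a4 = 0)
    by (apply (Rmult_eq_reg_l (24 * h ^ 4)); [lra | apply hn; lra]); subst a4.
  assert (E3 : a3 = 0)
    by (apply (Rmult_eq_reg_l (6 * h ^ 3)); [lra | apply hn; lra]); subst a3.
  assert (E2 : a2 = 0)
    by (apply (Rmult_eq_reg_l (2 * h ^ 2)); [lra | apply hn; lra]); subst a2.
  assert (E1 : a1 = 0)
    by (apply (Rmult_eq_reg_l (1 * h ^ 1)); [lra | apply hn; lra]); subst a1.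
  repeat split; lra.
Qed.

(** This form of the product rule keeps the factor [sqrt w], which the
    divergence with respect to a metric of determinant [w] divides out. *)
Lemma is_derive_sqrt_mult (w v : R -> R) (x dw dv : R) :
  0 < w x -> is_derive w x dw -> is_derive v x dv ->
  is_derive (fun s => sqrt (w s) * v s) x
    (sqrt (w x) * (dv + dw * v x / (2 * w x))).
Proof.
  intros Hw Dw Dv.
  assert (Hs := sqrt_lt_R0 _ Hw).
  assert (Hss := sqrt_sqrt _ (Rlt_le _ _ Hw)).
  assert (Ds := is_derive_sqrt _ _ _ Dw Hw).
  evar_last; [exact (is_derive_mult (fun s : R_AbsRing => sqrt (w s)) v x _ _ Ds Dv Rmult_comm) | ].
  change (dw / (2 * sqrt (w x)) * v x + sqrt (w x) * dv =
    sqrt (w x) * (dv + dw * v x / (2 * w x))).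
  replace (dw * v x / (2 * w x))
    with (dw * v x / (2 * (sqrt (w x) * sqrt (w x)))) by now rewrite Hss.
  field; lra.
Qed.

(** * Curvature of a sheared metric *)

(** Parametrised by its determinant [L t + u ^ 2] rather than by the entry
    [g_11], because the curvature depends on [L] alone. *)
Definition sheared_metric (L phi : R -> R) : tensor2 :=
  quadratic_form (fun t u => L t + u ^ 2 + phi t ^ 2) (fun t _ => phi t)
    (fun _ _ => 1).

(** [g] is only required to agree with the sheared metric on the rectangle,
    since [ruled_metric f lam] does so only where [lam ^ 2 <= f ^ 2]. *)
Record sheared_on (I J : R -> Prop) (L phi : R -> R) (g : tensor2) : Prop := {
  sh_openI : open I;
  sh_openJ : open J;
  sh_L : forall t, I t -> ex_derive L t;
  sh_L' : forall t, I t -> ex_derive (Derive L) t;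
  sh_phi : forall t, I t -> ex_derive phi t;
  sh_pos : forall t u, I t -> J u -> 0 < L t + u ^ 2;
  sh_eq : tensor2_eq_on (rectangle I J) g (sheared_metric L phi) }.

Arguments partial : simpl never.

Section Sheared.
Context (I J : R -> Prop) (L phi : R -> R) (g : tensor2).
Context (S : sheared_on I J L phi g).

Let oI := sh_openI _ _ _ _ _ S.
Let oJ := sh_openJ _ _ _ _ _ S.

Lemma sheared_entry (i j : axis) (t u : R) : I t -> J u ->
  g i j t u = sheared_metric L phi i j t u.
Proof. intros; apply (sh_eq _ _ _ _ _ S); now split. Qed.

Lemma sheared_gdet (t u : R) : I t -> J u -> gdet g t u = L t + u ^ 2.
Proof.
  intros It Ju; unfold gdet; rewrite !sheared_entry by assumption; simpl; ring.
Qed.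

Lemma sheared_partial (i j k : axis) (t u : R) : I t -> J u ->
  partial i (g j k) t u =
  match i, j, k with
  | ax1, ax1, ax1 => Derive L t + 2 * phi t * Derive phi t
  | ax2, ax1, ax1 => 2 * u
  | ax1, ax1, ax2 | ax1, ax2, ax1 => Derive phi t
  | _, _, _ => 0
  end.
Proof.
  intros It Ju.
  apply (partial_eq_on I J oI oJ i _ (sheared_metric L phi j k)); try assumption.
  - intros; now apply sheared_entry.
  - assert (HL := sh_L _ _ _ _ _ S t It); assert (Hp := sh_phi _ _ _ _ _ S t It).
    destruct i, j, k; simpl; auto_derive; auto;
      change (fun x => L x) with L; change (fun x => phi x) with phi; ring.
Qed.

Lemma sheared_christoffel_12 (k : axis) (t u : R) : I t -> J u ->
  christoffel g k ax1 ax2 t u =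
    match k with ax1 => u | ax2 => - phi t * u end / (L t + u ^ 2) /\
  christoffel g k ax2 ax1 t u =
    match k with ax1 => u | ax2 => - phi t * u end / (L t + u ^ 2).
Proof.
  intros It Ju; assert (HD := sh_pos _ _ _ _ _ S t u It Ju).
  destruct k; split; unfold christoffel, sum_axis, ginv;
  rewrite !sheared_partial, !sheared_gdet, !sheared_entry by assumption;
  simpl; field; simpl in HD; lra.
Qed.

(** The u-lines are geodesics: [g_22] is constant and [g_12] does not depend
    on [u]. *)
Lemma sheared_christoffel_22 (k : axis) (t u : R) : I t -> J u ->
  christoffel g k ax2 ax2 t u = 0.
Proof.
  intros It Ju; unfold christoffel, sum_axis;
  rewrite !sheared_partial by assumption; ring.
Qed.

(** As [Gamma^k_22 = 0], only the derivative of [Gamma^l_12] along [u] and one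
    product of such symbols survive; the symbols [Gamma^k_11], hence the
    derivatives of [L] and [phi], drop out. *)
Lemma sheared_riemann (l : axis) (t u : R) : I t -> J u ->
  riemann g l ax2 ax1 ax2 t u =
  match l with ax1 => -1 | ax2 => phi t end * L t / (L t + u ^ 2) ^ 2.
Proof.
  intros It Ju; assert (HD := sh_pos _ _ _ _ _ S t u It Ju).
  assert (P1 : partial ax1 (christoffel g l ax2 ax2) t u = 0).
  { apply (partial_eq_on I J oI oJ ax1 _ (fun _ _ => 0)); try assumption.
    - intros; now apply sheared_christoffel_22.
    - exact (is_derive_const 0 t). }
  assert (P2 : partial ax2 (christoffel g l ax1 ax2) t u =
    match l with ax1 => 1 | ax2 => - phi t end * (L t - u ^ 2) /
      (L t + u ^ 2) ^ 2).
  { apply (partial_eq_on I J oI oJ ax2 _ (fun t u =>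
      match l with ax1 => u | ax2 => - phi t * u end / (L t + u ^ 2)));
      try assumption.
    - intros; now apply sheared_christoffel_12.
    - destruct l; simpl; simpl in HD; auto_derive; try lra; field; lra. }
  unfold riemann, sum_axis; rewrite P1, P2, !sheared_christoffel_22 by assumption.
  rewrite !(proj1 (sheared_christoffel_12 _ _ _ It Ju)),
    !(proj2 (sheared_christoffel_12 _ _ _ It Ju)).
  destruct l; simpl; simpl in HD; field; lra.
Qed.

Lemma sheared_curvature (t u : R) : I t -> J u ->
  gauss_curvature g t u = - L t / (L t + u ^ 2) ^ 2.
Proof.
  intros It Ju; assert (HD := sh_pos _ _ _ _ _ S t u It Ju).
  unfold gauss_curvature, sum_axis.
  rewrite !sheared_riemann, sheared_gdet, !sheared_entry by assumption.
  simpl; simpl in HD; field; lra.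
Qed.

Lemma sheared_curvature_partial (i : axis) (t u : R) : I t -> J u ->
  partial i (gauss_curvature g) t u =
  match i with
  | ax1 => Derive L t * (L t - u ^ 2)
  | ax2 => 4 * L t * u
  end / (L t + u ^ 2) ^ 3.
Proof.
  intros It Ju; assert (HD := sh_pos _ _ _ _ _ S t u It Ju).
  assert (HL := sh_L _ _ _ _ _ S t It).
  apply (partial_eq_on I J oI oJ i _ (fun t u => - L t / (L t + u ^ 2) ^ 2));
    try assumption.
  - intros; now apply sheared_curvature.
  - destruct i; simpl; simpl in HD; auto_derive;
      try (repeat split; auto; nra); try (change (Derive (fun x => L x) t) with (Derive L t)); field; lra.
Qed.

Lemma sheared_grad (i : axis) (t u : R) : I t -> J u ->
  grad g (gauss_curvature g) i t u =
  match i with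
  | ax1 => Derive L t * (L t - u ^ 2) - 4 * phi t * L t * u
  | ax2 => (L t + u ^ 2 + phi t ^ 2) * (4 * L t * u)
           - phi t * (Derive L t * (L t - u ^ 2))
  end / (L t + u ^ 2) ^ 4.
Proof.
  intros It Ju; assert (HD := sh_pos _ _ _ _ _ S t u It Ju).
  unfold grad, sum_axis, ginv.
  rewrite !sheared_curvature_partial, sheared_gdet by assumption.
  destruct i; simpl; rewrite !sheared_entry by assumption; simpl; simpl in HD;
  field; lra.
Qed.

Lemma sheared_gnorm_grad (t u : R) : I t -> J u ->
  gnorm g (grad g (gauss_curvature g)) t u ^ 2 =
  (Derive L t * (L t - u ^ 2) - 4 * phi t * L t * u) ^ 2 / (L t + u ^ 2) ^ 7
  + (4 * L t * u) ^ 2 / (L t + u ^ 2) ^ 6.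
Proof.
  intros It Ju; assert (HD := sh_pos _ _ _ _ _ S t u It Ju).
  unfold gnorm; rewrite pow2_sqrt; unfold sum_axis;
    rewrite !sheared_grad, !sheared_entry by assumption.
  - simpl; simpl in HD; field; lra.
  - replace (_ + _) with
      ((Derive L t * (L t - u ^ 2) - 4 * phi t * L t * u) ^ 2 / (L t + u ^ 2) ^ 7
       + (4 * L t * u) ^ 2 / (L t + u ^ 2) ^ 6)
      by (simpl; simpl in HD; field; lra).
    apply Rplus_le_le_0_compat; apply Rmult_le_pos; try apply pow2_ge_0;
    left; apply Rinv_0_lt_compat; now apply pow_lt.
Qed.

(** * The Ricci expression *)

(** With [D = L + u ^ 2], [N] is [D ^ 3 * (K_t - phi * K_u)].  The gradient of
    [K] has components [N / D ^ 4] and [4 L u / D ^ 3 - phi * N / D ^ 4]; the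
    first two summands below come from the terms with [N], the last one from
    [4 L u / D ^ 3]. *)
Definition laplacian_numerator (L phi : R -> R) (t u : R) : R :=
  let D := L t + u ^ 2 in
  let N := Derive L t * (L t - u ^ 2) - 4 * phi t * L t * u in
  D * ((Derive (Derive L) t * (L t - u ^ 2) + Derive L t ^ 2
        - 4 * Derive phi t * L t * u - 4 * phi t * Derive L t * u)
       - phi t * (- 2 * Derive L t * u - 4 * phi t * L t))
  - 7 / 2 * N * (Derive L t - 2 * phi t * u)
  + 4 * L t * D * (L t - 4 * u ^ 2).

(** The square root of the determinant enters the divergence only through its
    logarithmic derivative, in which no square root remains. *)
Lemma sheared_gdiv (V V0 : vfield) (d : axis -> R) (t u : R) : I t -> J u ->
  (forall i s r, I s -> J r -> V i s r = V0 i s r) ->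
  (forall i, is_partial i (V0 i) t u (d i)) ->
  gdiv g V t u =
  d ax1 + d ax2
  + (Derive L t * V0 ax1 t u + 2 * u * V0 ax2 t u) / (2 * (L t + u ^ 2)).
Proof.
  intros It Ju EV HV; assert (HD := sh_pos _ _ _ _ _ S t u It Ju).
  assert (HL := sh_L _ _ _ _ _ S t It).
  assert (Hs := sqrt_lt_R0 _ HD).
  unfold gdiv, sum_axis; rewrite sheared_gdet by assumption.
  assert (P : forall i, partial i (fun s r => sqrt (gdet g s r) * V i s r) t u =
    sqrt (L t + u ^ 2) * (d i +
      match i with ax1 => Derive L t | ax2 => 2 * u end * V0 i t u
        / (2 * (L t + u ^ 2)))).
  { intros i.
    apply (partial_eq_on I J oI oJ i _
      (fun s r => sqrt (L s + r ^ 2) * V0 i s r)); try assumption.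
    - intros; now rewrite sheared_gdet, EV.
    - assert (HDi : is_partial i (fun s r => L s + r ^ 2) t u
        match i with ax1 => Derive L t | ax2 => 2 * u end).
      { destruct i; simpl; auto_derive; auto; change (fun x => L x) with L; ring. }
      specialize (HV i).
      destruct i; [exact (is_derive_sqrt_mult _ _ _ _ _ HD HDi HV)
                  | exact (is_derive_sqrt_mult _ _ _ _ _ HD HDi HV)]. }
  rewrite !P; field; lra.
Qed.

Lemma sheared_laplacian (t u : R) : I t -> J u ->
  laplacian g (gauss_curvature g) t u =
  laplacian_numerator L phi t u / (L t + u ^ 2) ^ 5.
Proof.
  intros It Ju; assert (HD := sh_pos _ _ _ _ _ S t u It Ju).
  assert (HL := sh_L _ _ _ _ _ S t It).
  assert (HL' := sh_L' _ _ _ _ _ S t It).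
  assert (Hp := sh_phi _ _ _ _ _ S t It).
  unfold laplacian.
  set (D := L t + u ^ 2) in *.
  set (N := Derive L t * (L t - u ^ 2) - 4 * phi t * L t * u).
  set (N_t := Derive (Derive L) t * (L t - u ^ 2) + Derive L t ^ 2
    - 4 * Derive phi t * L t * u - 4 * phi t * Derive L t * u).
  set (N_u := - 2 * Derive L t * u - 4 * phi t * L t).
  rewrite (sheared_gdiv _
    (fun i t u => match i with
       | ax1 => Derive L t * (L t - u ^ 2) - 4 * phi t * L t * u
       | ax2 => (L t + u ^ 2 + phi t ^ 2) * (4 * L t * u)
                - phi t * (Derive L t * (L t - u ^ 2))
       end / (L t + u ^ 2) ^ 4)
    (fun i => match i with
       | ax1 => (N_t * D - 4 * N * Derive L t) / D ^ 5
       | ax2 => 4 * L t * (L t - 5 * u ^ 2) / D ^ 4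
                - phi t * (N_u * D - 8 * N * u) / D ^ 5
       end)); [ | assumption | assumption | | ].
  - unfold laplacian_numerator; fold D N N_t N_u; unfold N_t, N_u, N, D in *.
    simpl in *; field; lra.
  - intros; now apply sheared_grad.
  - assert (HD' : D <> 0) by lra.
    unfold N_t, N_u, N, D in *; intros i; destruct i; simpl; auto_derive;
      try (repeat split; auto; exact (pow_nonzero _ 4 HD'));
      change (fun x => Derive L x) with (Derive L); change (fun x => L x) with L;
      change (fun x => phi x) with phi; simpl in HD; field; lra.
Qed.

(** Where [K] does not vanish, the left-hand side is
    [K ^ 2 * (Laplacian (ln |K|) - 4 K)]; as [ln |K| = ln |L| - 2 ln D], this
    explains why so few powers of [D] occur in the denominator and why the
    numerator is only quartic in [u]. *)
Lemma sheared_ricci (t u : R) : I t -> J u ->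
  let K := gauss_curvature g in
  let l := L t in let l' := Derive L t in let l'' := Derive (Derive L) t in
  let p := phi t in let p' := Derive phi t in
  K t u * laplacian g K t u - gnorm g (grad g K) t u ^ 2 - 4 * K t u ^ 3 =
  ((l * l'' - l' ^ 2) * u ^ 4 + l * (4 * l * p' + l' * p) * u ^ 3
   + l * (8 * l * p ^ 2 - 5 / 2 * l' ^ 2) * u ^ 2
   + l ^ 2 * (4 * l * p' - 11 * l' * p) * u
   + l ^ 2 * (3 / 2 * l' ^ 2 - l * l'' - 4 * l * p ^ 2)) / (l + u ^ 2) ^ 7.
Proof.
  intros It Ju; assert (HD := sh_pos _ _ _ _ _ S t u It Ju).
  intros K l l' l'' p p'; unfold K.
  rewrite sheared_laplacian, sheared_gnorm_grad, sheared_curvature by assumption.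
  unfold laplacian_numerator; fold l l' l'' p p'.
  fold l in HD; simpl; simpl in HD; field; lra.
Qed.

(** * Rigidity of the Ricci condition *)

(** The coefficient of [u ^ 4] gives [L L'' = L' ^ 2].  After this substitution
    the constant coefficient and that of [u ^ 2] are two independent linear
    combinations of [L' ^ 2] and [L phi ^ 2], up to powers of [L]. *)
Lemma sheared_ricci_rigid (v : R) : J v ->
  (forall t u, I t -> J u -> let K := gauss_curvature g in
     K t u * laplacian g K t u - gnorm g (grad g K) t u ^ 2 - 4 * K t u ^ 3 = 0) ->
  forall t, I t -> L t * Derive L t = 0 /\ L t * phi t = 0.
Proof.
  intros Jv H t It.
  destruct (quartic_vanishing_on_open J
    (L t ^ 2 * (3 / 2 * Derive L t ^ 2 - L t * Derive (Derive L) t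
                - 4 * L t * phi t ^ 2))
    (L t ^ 2 * (4 * L t * Derive phi t - 11 * Derive L t * phi t))
    (L t * (8 * L t * phi t ^ 2 - 5 / 2 * Derive L t ^ 2))
    (L t * (4 * L t * Derive phi t + Derive L t * phi t))
    (L t * Derive (Derive L) t - Derive L t ^ 2) v oJ Jv)
    as (C0 & _ & C2 & _ & C4).
  - intros u Ju.
    specialize (H t u It Ju); cbv zeta in H.
    rewrite sheared_ricci in H by assumption; cbv zeta in H.
    assert (HD := sh_pos _ _ _ _ _ S t u It Ju).
    apply Rmult_integral in H as [H | H]; [exact H | exfalso].
    revert H; apply Rinv_neq_0_compat, pow_nonzero; lra.
  - set (l := L t) in *; set (l' := Derive L t) in *; set (p := phi t) in *.
    replace (l * Derive (Derive L) t) with (l' ^ 2) in C0 by lra.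
    (* Twice the constant coefficient plus [l] times that of [u ^ 2] cancels
       [p]. *)
    assert (Z : (l * l') ^ 2 = 0).
    { replace ((l * l') ^ 2) with
        (- 2 / 3 * (2 * (l ^ 2 * (3 / 2 * l' ^ 2 - l' ^ 2 - 4 * l * p ^ 2))
         + l * (l * (8 * l * p ^ 2 - 5 / 2 * l' ^ 2)))) by field.
      rewrite C0, C2; ring. }
    split.
    + apply Rsqr_0_uniq; rewrite Rsqr_pow2; exact Z.
    + destruct (Req_dec l 0) as [-> | nz]; [ring | ].
      assert (Z' : (l * p) ^ 2 * l = 0).
      { replace ((l * p) ^ 2 * l) with
          (/ 8 * (l * (l * (8 * l * p ^ 2 - 5 / 2 * l' ^ 2)) + 5 / 2 * (l * l') ^ 2))
          by field.
        rewrite C2, Z; ring. }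
      apply Rmult_integral in Z' as [Z' | Z']; [ | contradiction].
      apply Rsqr_0_uniq; rewrite Rsqr_pow2; exact Z'.
Qed.
End Sheared.

(** * The ruled metric *)

Definition lam2 (lam : R -> R) (t : R) : R := lam t ^ 2.
Definition shear (f lam : R -> R) (t : R) : R := sqrt (f t ^ 2 - lam t ^ 2).

Lemma ruled_sheared_on (I J : R -> Prop) (f lam : R -> R) (v : R) :
  open I -> open J -> J v ->
  smooth_on I lam -> (forall t, I t -> f t ^ 2 >= lam t ^ 2) ->
  riemannian_metric (rectangle I J) (ruled_metric f lam) ->
  sheared_on I J (lam2 lam) (shear f lam) (ruled_metric f lam).
Proof.
  intros oI oJ Jv hlam hle [smooth pos].
  assert (D1 : forall t, I t -> ex_derive lam t) by (intros t It; exact (hlam 1%nat t It)).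
  assert (D2 : forall t, I t -> ex_derive (Derive lam) t)
    by (intros t It; exact (hlam 2%nat t It)).
  assert (phi2 : forall t, I t -> shear f lam t ^ 2 = f t ^ 2 - lam t ^ 2).
  { intros t It; apply pow2_sqrt; specialize (hle t It); lra. }
  split; try assumption.
  - intros t It; unfold lam2; auto_derive; auto.
  - intros t It.
    apply (ex_derive_ext_loc (fun s => 2 * lam s * Derive lam s)).
    + apply (filter_imp I); [ | now apply oI].
      intros s Is; symmetry; apply is_derive_unique; unfold lam2.
      auto_derive; [auto | change (fun x => lam x) with lam; ring].
    + auto_derive; auto.
  - intros t It.
    destruct (smooth ax1 ax2 1%nat) as [_ H].
    destruct (H ax1) as [Hd _]; exact (Hd t v (conj It Jv)).
  - intros t u It Ju.
    destruct (pos t u (conj It Ju)) as [_ P].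
    (* The vector (1, - phi) is orthogonal to the u-line; its squared length
       is the determinant. *)
    specialize (P (fun i => match i with ax1 => 1 | ax2 => - shear f lam t end)).
    unfold sum_axis in P; simpl in P; fold (f t ^ 2) in P.
    change (sqrt _) with (shear f lam t) in P.
    specialize (phi2 t It); unfold lam2.
    enough (0 < f t ^ 2 + u ^ 2 - shear f lam t ^ 2) by lra.
    refine (Rlt_le_trans _ _ _ (P _) _); [exists ax1; lra | right; ring].
  - intros i j t u [It _]; destruct i, j; simpl; try reflexivity.
    specialize (phi2 t It); unfold lam2; simpl in *; lra.
Qed.

Theorem lemma1 (I J : R -> Prop) (f lam : R -> R)
  (hI : is_open_interval I) (hJ : is_open_interval J)
  (hf : smooth_on I f) (hlam : smooth_on I lam)
  (hle : forall t, I t -> f t ^ 2 >= lam t ^ 2)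
  (hg : riemannian_metric (rectangle I J) (ruled_metric f lam))
  (hK : non_flat (rectangle I J) (ruled_metric f lam)) :
  (ricci_metric (rectangle I J) (ruled_metric f lam) <->
   exists c : R, c > 0 /\
     forall t, I t -> lam t ^ 2 = f t ^ 2 /\ f t ^ 2 = c ^ 2) /\
  (forall c : R, c > 0 ->
     (forall t, I t -> lam t ^ 2 = f t ^ 2 /\ f t ^ 2 = c ^ 2) ->
     tensor2_eq_on (rectangle I J) (ruled_metric f lam)
       (quadratic_form (fun t u => c ^ 2 + u ^ 2)
                       (fun t u => 0)
                       (fun t u => 1))).
Proof.
  assert (oI := open_interval_open I hI); assert (oJ := open_interval_open J hJ).
  assert (sheared : forall v, J v ->
    sheared_on I J (lam2 lam) (shear f lam) (ruled_metric f lam)).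
  { intros v Jv; now apply ruled_sheared_on with v. }
  split; [split | ].
  - intros [_ ricci].
    apply NNPP; intros absurd; apply hK; intros t0 v [It0 Jv].
    assert (S := sheared v Jv).
    rewrite (sheared_curvature I J _ _ _ S) by assumption.
    destruct (Req_dec (lam2 lam t0) 0) as [-> | nz]; [unfold Rdiv; ring | exfalso].
    apply absurd.
    assert (rigid := sheared_ricci_rigid I J _ _ _ S v Jv
      (fun t u It Ju => ricci t u (conj It Ju))).
    assert (pos : forall t, 0 <= lam2 lam t) by (intros; apply pow2_ge_0).
    (* The identity [L L' = 0] controls the derivative of [L ^ 2], not that of
       [L] itself; nonnegativity then gives back [L]. *)
    assert (const : forall t, I t -> lam2 lam t = lam2 lam t0).
    { intros t It.
      apply Rsqr_inj; [apply pos | apply pos | ].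
      apply (constant_of_zero_derivative I (fun s => Rsqr (lam2 lam s))); try assumption.
      intros s Is; assert (Hs := sh_L _ _ _ _ _ S s Is).
      unfold Rsqr; auto_derive; [auto | ].
      change (fun x => lam2 lam x) with (lam2 lam).
      replace 0 with (2 * (lam2 lam s * Derive (lam2 lam) s)); [ring | ].
      rewrite (proj1 (rigid s Is)); ring. }
    exists (sqrt (lam2 lam t0)); split.
    { apply sqrt_lt_R0; specialize (pos t0); lra. }
    intros t It; rewrite pow2_sqrt by apply pos.
    enough (f t ^ 2 - lam t ^ 2 = 0) by
      (rewrite <- (const t It); unfold lam2; lra).
    destruct (Rmult_integral _ _ (proj2 (rigid t It))) as [Z | Z].
    + rewrite const in Z by assumption; contradiction.
    + apply sqrt_eq_0; [specialize (hle t It); lra | exact Z].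
  (* Here [L = c ^ 2] and [phi = 0] near [t], so every derivative in the
     formula for the Ricci expression vanishes. *)
  - intros (c & c0 & Hc); split; [exact hg | ].
    intros t u [It Ju] K; unfold K; clear K.
    assert (S := sheared u Ju).
    rewrite (sheared_ricci I J _ _ _ S) by assumption.
    assert (Lc : forall s, I s -> lam2 lam s = c ^ 2).
    { intros s Is; destruct (Hc s Is); unfold lam2; lra. }
    assert (p0 : forall s, I s -> shear f lam s = 0).
    { intros s Is; destruct (Hc s Is) as [e _]; unfold shear.
      rewrite e, Rminus_diag; apply sqrt_0. }
    assert (dL : forall s, I s -> Derive (lam2 lam) s = 0).
    { intros s Is; rewrite (Derive_ext_loc _ (fun _ => c ^ 2)).
      - apply Derive_const.
      - now apply (filter_imp I); [exact Lc | apply oI]. }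
    assert (ddL : Derive (Derive (lam2 lam)) t = 0).
    { rewrite (Derive_ext_loc _ (fun _ => 0)).
      - apply Derive_const.
      - now apply (filter_imp I); [exact dL | apply oI]. }
    assert (dp : Derive (shear f lam) t = 0).
    { rewrite (Derive_ext_loc _ (fun _ => 0)).
      - apply Derive_const.
      - now apply (filter_imp I); [exact p0 | apply oI]. }
    rewrite ddL, dp, dL, p0 by assumption; unfold Rdiv; ring.
  - intros c c0 Hc i j t u [It _]; destruct (Hc t It) as [e ec].
    destruct i, j; simpl; simpl in e, ec; try reflexivity.
    + now rewrite ec.
    + rewrite e, Rminus_diag; apply sqrt_0.
    + rewrite e, Rminus_diag; apply sqrt_0.
Qed.
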